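(* Let $K$ be a locally compact Hausdorff topological group, let $\mathscr{G}$ and $\mathscr{H}$ be topological groupoids and let $P$ be a topological principal $\mathscr{G}$-bundle over $\mathscr{H}$ which represents a Morita equivalence from $\mathscr{H}$ to $\mathscr{G}$. Let $\sigma\in\hom(K,\mathscr{H})$, let $p\in P$ satisfy $\pi(p)=\omega(\sigma)$ and put $\rho=P_p\circ\sigma\in\hom(K,\mathscr{G})$. Then $$\mathrm{Mon}(\mathscr{H};\sigma)=\mathrm{Mon}(\mathscr{G};\rho).$$
   Context: A topological groupoid $\mathscr{G}$ is a groupoid with topologies on its set of arrows $\mathscr{G}_1$ (also written $\mathscr{G}$) and its set of objects $\mathscr{G}_0$ such that all structure maps are continuous; $\mathrm{s},\mathrm{t}$ are source and target, and $\mathrm{I}_x(\mathscr{G})$ is the isotropy group (arrows from $x$ to $x$). Monodromy group: $\hom(K,\mathscr{G})$ is the set of all pairs of a point $\omega(\varphi)\in\mathscr{G}_0$ and a continuous group homomorphism $\varphi:K\to\mathrm{I}_{\omega(\varphi)}(\mathscr{G})$, with the compact-open topology as a subspace of $C(K,\mathscr{G}_1)$. $\mathscr{G}$ acts on it from the left along $\omega$ by $(g\varphi)(k)=g\varphi(k)g^{-1}$, for $\mathrm{s}(g)=\omega(\varphi)$. For $\rho\in\hom(K,\mathscr{G})$, $\hom(K,\mathscr{G};\rho)$ is the smallest subset of $\hom(K,\mathscr{G})$ which contains $\rho$, is a union of path-components of $\hom(K,\mathscr{G})$ and is invariant under the $\mathscr{G}$-action. With $\mathrm{Aut}(K)$ the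 group of automorphisms of the topological group $K$, $$\mathrm{Mon}(\mathscr{G};\rho)=\{\mu\in\mathrm{Aut}(K)\;|\;\hom(K,\mathscr{G};\rho)\circ\mu=\hom(K,\mathscr{G};\rho)\}.$$ Principal bundles: a topological principal $\mathscr{G}$-bundle over $\mathscr{H}$ is a topological space $P$ with a continuous right $\mathscr{G}$-action along a continuous map $\epsilon:P\to\mathscr{G}_0$ (where $pg$ is defined if $\epsilon(p)=\mathrm{t}(g)$, and $\epsilon(pg)=\mathrm{s}(g)$) and a continuous left $\mathscr{H}$-action along a surjective continuous map $\pi:P\to\mathscr{H}_0$ with local sections (where $hp$ is defined if $\mathrm{s}(h)=\pi(p)$, and $\pi(hp)=\mathrm{t}(h)$), such that $\pi(pg)=\pi(p)$, $\epsilon(hp)=\epsilon(p)$, $h(pg)=(hp)g$, and the map $P\times_{\mathscr{G}_0}^{\epsilon,\mathrm{t}}\mathscr{G}_1\to P\times_{\mathscr{H}_0}^{\pi,\pi}P$, $(p,g)\mapsto(p,pg)$, is a homeomorphism. Each $p\in P$ induces a homomorphism of topological groups $P_p:\mathrm{I}_{\pi(p)}(\mathscr{H})\to\mathrm{I}_{\epsilon(p)}(\mathscr{G})$ determined by $hp=pP_p(h)$. Isomorphisms of principal bundles are homeomorphisms equivariant for both actions. The Morita category has topological groupoids as objects and isomorphism classes of topological principal $\mathscr{G}$-bundles over $\mathscr{H}$ as morphisms from $\mathscr{H}$ to $\mathscr{G}$; composition is induced by the tensor product $Q\otimes_{\mathscr{H}}P$, the orbit space of $Q\times_{\mathscr{H}_0}^{\epsilon,\pi}P$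 under the diagonal $\mathscr{H}$-action, for $Q$ a principal $\mathscr{H}$-bundle over a groupoid $\mathscr{K}$. $P$ represents a Morita equivalence if its class is an isomorphism in this category. *)

(* Defs.v *)
From HB Require Import structures.
From mathcomp Require Import all_boot all_order all_algebra.
From mathcomp Require Import all_classical all_reals topology normedtype.

Import numFieldNormedType.Exports.

Set Implicit Arguments.
Unset Strict Implicit.
Unset Printing Implicit Defensive.

Local Open Scope classical_set_scope.
Local Open Scope quotient_scope.

HB.mixin Record isTopologicalGroup K of Topological K & Group K := {
  mulg_continuous : continuous (fun x : K * K => (x.1 * x.2)%g);
  invg_continuous : continuous (fun x : K => (x^-1)%g)
}.

#[short(type="topologicalGroupType")]
HB.structure Definition TopologicalGroup :=
  {K of isTopologicalGroup K & Topological K & Group K}.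

Definition homeomorphism (X Y : topologicalType) (f : X -> Y) : Prop :=
  continuous f /\ exists g, [/\ continuous g, cancel f g & cancel g f].

Definition fprod (X Y Z : Type) (f : X -> Z) (g : Y -> Z) : set (X * Y) :=
  [set x | f x.1 = g x.2].

Section Paths.
Variable R : realType.

Definition path_component (X : topologicalType) (x : X) : set X :=
  [set y | exists gamma : R -> X,
    [/\ {within `[0%R, 1%R], continuous gamma},
        gamma 0%R = x & gamma 1%R = y]].

Definition union_of_path_components (X : topologicalType) (A : set X) : Prop :=
  exists S : set X, A = \bigcup_(x in S) path_component x.

End Paths.

(* Compositions and actions defined on a fibre product only are encoded as   *)
(* total functions: their values outside the fibre product are irrelevant,   *)
(* and all the axioms are restricted to it.                                  *)

Record topGroupoid := TopGroupoid {
  obj : topologicalType;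
  arr : topologicalType;
  src : arr -> obj;
  tgt : arr -> obj;
  gone : obj -> arr;
  ginv : arr -> arr;
  gmul : arr -> arr -> arr;
  src_continuous : continuous src;
  tgt_continuous : continuous tgt;
  gone_continuous : continuous gone;
  ginv_continuous : continuous ginv;
  gmul_continuous :
    {within fprod src tgt, continuous (fun x : arr * arr => gmul x.1 x.2)};
  src_gone : forall x, src (gone x) = x;
  tgt_gone : forall x, tgt (gone x) = x;
  src_gmul : forall g h, src g = tgt h -> src (gmul g h) = src h;
  tgt_gmul : forall g h, src g = tgt h -> tgt (gmul g h) = tgt g;
  gmulA : forall g h k, src g = tgt h -> src h = tgt k ->
    gmul g (gmul h k) = gmul (gmul g h) k;
  gmul1g : forall g, gmul (gone (tgt g)) g = g;
  gmulg1 : forall g, gmul g (gone (src g)) = g;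
  src_ginv : forall g, src (ginv g) = tgt g;
  tgt_ginv : forall g, tgt (ginv g) = src g;
  gmulVg : forall g, gmul (ginv g) g = gone (src g);
  gmulgV : forall g, gmul g (ginv g) = gone (tgt g)
}.

Definition isotropy (G : topGroupoid) (x : obj G) : set (arr G) :=
  [set g | src g = x /\ tgt g = x].

Definition to_set_type (X : Type) (A : set X) (x : X) (Ax : A x) : A :=
  exist _ x (mem_set Ax).

Lemma continuous_comp_within (T X Y : topologicalType) (A : set X)
    (f : T -> X) (g : X -> Y) :
  continuous f -> (forall t, A (f t)) -> {within A, continuous g} ->
  continuous (fun t => g (f t)).
Proof.
move=> cf fA /subspace_sigL_continuousP cg.
pose f' t : A := to_set_type (fA t).
have cf' : continuous f' by apply: continuous_comp_initial.
have -> : (fun t => g (f t)) = sigL A g \o f' by [].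
by move=> t; apply: continuous_comp; [exact: cf'|exact: cg].
Qed.

Lemma continuous_pair (T X Y : topologicalType) (f : T -> X) (g : T -> Y) :
  continuous f -> continuous g -> continuous (fun t => (f t, g t)).
Proof. by move=> cf cg t; apply: cvg_pair; [exact: cf|exact: cg]. Qed.

Section Groupoid.
Variable G : topGroupoid.
Implicit Types g h k : arr G.

Lemma continuous_gmul (T : topologicalType) (u v : T -> arr G) :
  continuous u -> continuous v -> (forall t, src (u t) = tgt (v t)) ->
  continuous (fun t => gmul (u t) (v t)).
Proof.
move=> cu cv uv.
exact: (continuous_comp_within (continuous_pair cu cv) uv (@gmul_continuous G)).
Qed.

Lemma gmulKV g h : src g = src h -> gmul (gmul g (ginv h)) h = g.
Proof.
move=> gh; rewrite -gmulA ?tgt_ginv ?src_ginv// gmulVg -gh.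
exact: gmulg1.
Qed.

Lemma gmulVK g h : src g = tgt h -> gmul (ginv g) (gmul g h) = h.
Proof.
move=> gh; rewrite gmulA ?tgt_ginv ?src_ginv// gmulVg gh; exact: gmul1g.
Qed.

Lemma gmulVKV g h : tgt g = tgt h -> gmul g (gmul (ginv g) h) = h.
Proof.
move=> gh; rewrite gmulA ?tgt_ginv ?src_ginv// gmulgV gh; exact: gmul1g.
Qed.

Lemma ginv_unique g h : src g = tgt h -> gmul g h = gone (tgt g) ->
  h = ginv g.
Proof.
move=> gh e.
by rewrite -(gmulVK gh) e -[in gone (tgt g)]src_ginv gmulg1.
Qed.

Lemma ginvK g : ginv (ginv g) = g.
Proof.
apply/esym/ginv_unique; first exact: src_ginv.
by rewrite gmulVg tgt_ginv.
Qed.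

Lemma ginvM g h : src g = tgt h -> ginv (gmul g h) = gmul (ginv h) (ginv g).
Proof.
move=> gh; have hg : src (ginv h) = tgt (ginv g) by rewrite src_ginv tgt_ginv.
apply/esym/ginv_unique; first by rewrite src_gmul// tgt_gmul// tgt_ginv.
rewrite -gmulA//; last by rewrite tgt_gmul// tgt_ginv.
by rewrite gmulVKV ?tgt_ginv// gmulgV tgt_gmul.
Qed.

Lemma ginv_gone x : ginv (gone x) = gone x :> arr G.
Proof.
apply/esym/ginv_unique; first by rewrite src_gone tgt_gone.
by rewrite -{2}(@src_gone G x) gmulg1 tgt_gone.
Qed.

End Groupoid.

Section Hom.
Variables (K : topologicalGroupType) (G : topGroupoid).

Record gpdHom := GpdHom {
  hom_base : obj G;
  hom_map :> K -> arr G;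
  hom_isotropy : forall k, isotropy hom_base (hom_map k);
  hom_mul : forall k l, hom_map (k * l)%g = gmul (hom_map k) (hom_map l);
  hom_continuous : continuous hom_map
}.

Lemma gpdHomP (phi psi : gpdHom) :
  hom_base phi = hom_base psi -> (forall k, phi k = psi k) -> phi = psi.
Proof.
case: phi psi => [x f fI fM cf] [y f' f'I f'M cf'] /= exy /funext eff'.
subst y f'; congr GpdHom; exact: Prop_irrelevance.
Qed.

HB.instance Definition _ := gen_eqMixin gpdHom.
HB.instance Definition _ := gen_choiceMixin gpdHom.
HB.instance Definition _ := Topological.copy gpdHom
  (initial_topology (hom_map : gpdHom -> {compact-open, K -> arr G})).

Section Conj.
Variables (g : arr G) (phi : gpdHom) (e : src g = hom_base phi).

Definition conj_map k := gmul (gmul g (phi k)) (ginv g).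

Let gphi k : src g = tgt (phi k).
Proof. by case: (hom_isotropy phi k) => _ ->. Qed.

Let phig k : src (gmul g (phi k)) = tgt (ginv g).
Proof. by rewrite src_gmul// tgt_ginv e; case: (hom_isotropy phi k). Qed.

Let phiS k : src (phi k) = src g.
Proof. by case: (hom_isotropy phi k) => -> _. Qed.

Lemma conj_isotropy k : isotropy (tgt g) (conj_map k).
Proof.
split; first by rewrite (src_gmul (phig k)) src_ginv.
by rewrite (tgt_gmul (phig k)) (tgt_gmul (gphi k)).
Qed.

Lemma conj_mul k l : conj_map (k * l)%g = gmul (conj_map k) (conj_map l).
Proof.
rewrite /conj_map hom_mul [in RHS]gmulA//; last first.
  by rewrite src_gmul// src_ginv tgt_gmul.
congr gmul; rewrite -[RHS]gmulA ?gmulVK// ?gmulA ?phiS//.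
by rewrite tgt_gmul// src_ginv.
Qed.

Lemma conj_continuous : continuous conj_map.
Proof.
apply: continuous_gmul => //; last by move=> t; exact: cvg_cst.
by apply: continuous_gmul => // [t|]; [exact: cvg_cst|exact: hom_continuous].
Qed.

(* g phi : k |-> g phi(k) g^-1, a homomorphism based at tgt g. *)
Definition hom_act : gpdHom := GpdHom conj_isotropy conj_mul conj_continuous.

End Conj.

Definition groupoid_invariant (A : set gpdHom) : Prop :=
  forall (g : arr G) (phi : gpdHom) (e : src g = hom_base phi),
    A phi -> A (hom_act e).

(* hom(K, G; rho) *)
Definition hom_orbit (R : realType) (rho : gpdHom) : set gpdHom :=
  smallest [set A | union_of_path_components R A /\ groupoid_invariant A]
    [set rho].

Record topAut := TopAut {
  aut_map :> K -> K;
  aut_mul : {morph aut_map : k l / (k * l)%g};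
  aut_homeo : homeomorphism aut_map
}.

Section Precomp.
Variables (phi : gpdHom) (mu : topAut).

Lemma precomp_mul k l : phi (mu (k * l)%g) = gmul (phi (mu k)) (phi (mu l)).
Proof. by rewrite aut_mul hom_mul. Qed.

Lemma precomp_continuous : continuous (fun k => phi (mu k)).
Proof.
move=> k; apply: (@continuous_comp _ _ _ mu phi).
  by case: (aut_homeo mu) => c _; exact: c.
exact: hom_continuous.
Qed.

Definition hom_precomp : gpdHom :=
  GpdHom (fun k => hom_isotropy phi (mu k)) precomp_mul precomp_continuous.

End Precomp.

Definition Mon (R : realType) (rho : gpdHom) : set topAut :=
  [set mu | [set hom_precomp phi mu | phi in hom_orbit R rho]
            = hom_orbit R rho].

End Hom.

(* Underlying data of a principal G-bundle over H, i.e. of a morphism from H *)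
(* to G in the Morita category: bproj is pi, banch is epsilon, H acts from   *)
(* the left along bproj and G from the right along banch.                    *)
Record bispace (H G : topGroupoid) := Bispace {
  bspace :> topologicalType;
  bproj : bspace -> obj H;
  banch : bspace -> obj G;
  blact : arr H -> bspace -> bspace;
  bract : bspace -> arr G -> bspace
}.

Record is_principal (H G : topGroupoid) (P : bispace H G) : Prop :=
  IsPrincipal {
  bproj_continuous : continuous (@bproj _ _ P);
  banch_continuous : continuous (@banch _ _ P);
  bproj_surj : forall x, exists p : P, bproj p = x;
  bproj_local_sections : forall x : obj H,
    exists (U : set (obj H)) (s : obj H -> P),
      [/\ open U, U x, {within U, continuous s} &
          forall y, U y -> bproj (s y) = y];
  banch_bract : forall (p : P) g, banch p = tgt g -> banch (bract p g) = src g;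
  bract1 : forall p : P, bract p (gone (banch p)) = p;
  bractM : forall (p : P) g g', banch p = tgt g -> src g = tgt g' ->
    bract p (gmul g g') = bract (bract p g) g';
  bract_continuous : {within fprod (@banch _ _ P) (@tgt G),
    continuous (fun x : P * arr G => bract x.1 x.2)};
  bproj_blact : forall h (p : P), src h = bproj p -> bproj (blact h p) = tgt h;
  blact1 : forall p : P, blact (gone (bproj p)) p = p;
  blactM : forall h h' (p : P), src h = tgt h' -> src h' = bproj p ->
    blact (gmul h h') p = blact h (blact h' p);
  blact_continuous : {within fprod (@src H) (@bproj _ _ P),
    continuous (fun x : arr H * P => blact x.1 x.2)};
  bproj_bract : forall (p : P) g, banch p = tgt g -> bproj (bract p g) = bproj p;
  banch_blact : forall h (p : P), src h = bproj p -> banch (blact h p) = banch p;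
  blact_bract : forall h (p : P) g, src h = bproj p -> banch p = tgt g ->
    blact h (bract p g) = bract (blact h p) g;
  bract_homeo :
    exists f : fprod (@banch _ _ P) (@tgt G) ->
               fprod (@bproj _ _ P) (@bproj _ _ P),
      homeomorphism f /\
      forall x, set_val (f x) =
                ((set_val x).1, bract (set_val x).1 (set_val x).2)
}.

Record principalBundle (H G : topGroupoid) := PrincipalBundle {
  pbispace :> bispace H G;
  pbundleP : is_principal pbispace
}.

(* The map P_p of the isotropy groups: the value at h is the unique g such   *)
(* that h p = p g, see bundle_mapP and bundle_map_unique.                    *)
Definition bundle_map (H G : topGroupoid) (P : bispace H G) (p : P)
    (h : arr H) : arr G :=
  xget (gone (banch p)) [set g | banch p = tgt g /\ blact h p = bract p g].

Section BundleMap.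
Variables (H G : topGroupoid) (P : principalBundle H G).
Implicit Types p : P.

Lemma bract_inj p g g' : banch p = tgt g -> banch p = tgt g' ->
  bract p g = bract p g' -> g = g'.
Proof.
move=> pg pg' e.
have [f [[_ [f' [_ fK _]]] fE]] := bract_homeo (pbundleP P).
pose x : fprod (@banch _ _ P) (@tgt G) := to_set_type (pg : fprod _ _ (p, g)).
pose y : fprod (@banch _ _ P) (@tgt G) := to_set_type (pg' : fprod _ _ (p, g')).
have : f x = f y.
  by apply: val_inj; rewrite -!set_valE !fE !set_valE /= e.
by move=> /(can_inj fK)/(congr1 (fun z => (\val z).2)).
Qed.

Lemma bundle_mapP p h : h \in isotropy (bproj p) ->
  isotropy (banch p) (bundle_map p h) /\
  blact h p = bract p (bundle_map p h).
Proof.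
rewrite inE => -[sh th].
have [f [[_ [f' [_ _ f'K]]] fE]] := bract_homeo (pbundleP P).
have php : fprod (@bproj _ _ P) (@bproj _ _ P) (p, blact h p).
  by rewrite /fprod/= (bproj_blact (pbundleP P)).
have := fE (f' (to_set_type php)).
rewrite f'K {1}set_valE /=; move: (f' _) => x; case: x => -[q g] qg.
rewrite !set_valE /= => -[pq e]; subst q; move/set_mem: qg => /= pg.
have [] := @xgetPex _ (gone (banch p))
  [set g | banch p = tgt g /\ blact h p = bract p g].
  by exists g; split.
rewrite -/(bundle_map p h) => pm hm; split => //; split => //.
by rewrite -(banch_bract (pbundleP P) pm) -hm (banch_blact (pbundleP P)).
Qed.

Lemma bundle_map_unique p h g : h \in isotropy (bproj p) -> banch p = tgt g ->
  blact h p = bract p g -> bundle_map p h = g.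
Proof.
move=> hI pg hg; have [[_ t] e] := bundle_mapP hI.
by apply: (@bract_inj p) => //; rewrite -e.
Qed.

Section Push.
Variables (K : topologicalGroupType) (sigma : gpdHom K H) (p : P).
Hypothesis e : bproj p = hom_base sigma.

Let sI k : sigma k \in isotropy (bproj p).
Proof. by rewrite inE e; exact: hom_isotropy. Qed.

Let ss k : src (sigma k) = bproj p.
Proof. by have := sI k; rewrite inE => -[]. Qed.

Let ts k : tgt (sigma k) = bproj p.
Proof. by have := sI k; rewrite inE => -[]. Qed.

Let bs k : src (bundle_map p (sigma k)) = banch p.
Proof. by have [[]] := bundle_mapP (sI k). Qed.

Let bt k : tgt (bundle_map p (sigma k)) = banch p.
Proof. by have [[]] := bundle_mapP (sI k). Qed.

Lemma push_isotropy k : isotropy (banch p) (bundle_map p (sigma k)).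
Proof. by have [] := bundle_mapP (sI k). Qed.

Lemma push_mul k l : bundle_map p (sigma (k * l)%g) =
  gmul (bundle_map p (sigma k)) (bundle_map p (sigma l)).
Proof.
have PP := pbundleP P.
apply: bundle_map_unique => //; first by rewrite tgt_gmul ?bs ?bt.
rewrite hom_mul (blactM PP) ?ss ?ts//.
have [_ el] := bundle_mapP (sI l); have [_ ek] := bundle_mapP (sI k).
by rewrite el (blact_bract PP) ?ss ?bt// ek -(bractM PP) ?bs ?bt.
Qed.

Lemma push_continuous : continuous (fun k => bundle_map p (sigma k)).
Proof.
have PP := pbundleP P.
have [f [[_ [f' [cf' _ f'K]]] fE]] := bract_homeo PP.
have php k : fprod (@bproj _ _ P) (@bproj _ _ P) (p, blact (sigma k) p).
  by rewrite /fprod/= (bproj_blact PP) ?ts.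
pose u k : fprod (@bproj _ _ P) (@bproj _ _ P) := to_set_type (php k).
have cu : continuous u.
  apply: continuous_comp_initial; apply: continuous_pair.
    by move=> k; exact: cvg_cst.
  have c : continuous (fun k => (sigma k, p)).
    apply: continuous_pair; first exact: hom_continuous.
    by move=> k; exact: cvg_cst.
  exact: (continuous_comp_within c (ss : forall k, fprod _ _ (sigma k, p))
            (blact_continuous PP)).
have -> : (fun k => bundle_map p (sigma k)) = snd \o (set_val \o (f' \o u)).
  apply/funext => k /=.
  have := fE (f' (u k)); rewrite f'K {1}set_valE /=.
  case: (f' (u k)) => -[q g] qg; rewrite !set_valE /= => -[pq eh]; subst q.
  move/set_mem: qg => /= pg.
  exact: bundle_map_unique.
move=> k; apply: continuous_comp; last exact: cvg_snd.
apply: continuous_comp; last exact: initial_continuous.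
by apply: continuous_comp; [exact: cu|exact: cf'].
Qed.

(* P_p \o sigma *)
Definition bundle_push : gpdHom K G :=
  GpdHom push_isotropy push_mul push_continuous.

End Push.
End BundleMap.

Definition bispace_iso (H G : topGroupoid) (P P' : bispace H G)
    (f : P -> P') : Prop :=
  [/\ homeomorphism f,
      forall p, bproj (f p) = bproj p /\ banch (f p) = banch p,
      forall h p, src h = bproj p -> f (blact h p) = blact h (f p) &
      forall p g, banch p = tgt g -> f (bract p g) = bract (f p) g].

Definition isomorphic (H G : topGroupoid) (P P' : bispace H G) : Prop :=
  exists f : P -> P', bispace_iso f.

(* The identity of G in the Morita category. *)
Section UnitBundle.
Variable G : topGroupoid.

Definition unit_bispace : bispace G G :=
  @Bispace G G (arr G) (@tgt G) (@src G) (@gmul G) (@gmul G).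

Lemma unit_principal : is_principal unit_bispace.
Proof.
split => //=.
- exact: tgt_continuous.
- exact: src_continuous.
- by move=> x; exists (gone x); exact: tgt_gone.
- move=> x; exists setT, (@gone G); split => //; first exact: openT.
    by apply: continuous_subspaceT; exact: gone_continuous.
  by move=> y _; exact: tgt_gone.
- exact: src_gmul.
- exact: gmulg1.
- by move=> p g g' pg gg'; exact: gmulA.
- exact: gmul_continuous.
- exact: tgt_gmul.
- exact: gmul1g.
- by move=> h h' p hh' h'p; rewrite gmulA.
- exact: gmul_continuous.
- exact: tgt_gmul.
- exact: src_gmul.
- by move=> h p g hp pg; exact: gmulA.
have mem1 (x : fprod (@src G) (@tgt G)) : fprod (@tgt G) (@tgt G)
    ((\val x).1, gmul (\val x).1 (\val x).2).
  by case: x => x /set_mem /= xP; rewrite /fprod/= tgt_gmul.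
have mem2 (x : fprod (@tgt G) (@tgt G)) : fprod (@src G) (@tgt G)
    ((\val x).1, gmul (ginv (\val x).1) (\val x).2).
  by case: x => x /set_mem /= xP; rewrite /fprod/= tgt_gmul ?tgt_ginv ?src_ginv.
have c1 (A : set (arr G * arr G)) : continuous (fun x : A => (\val x).1).
  move=> x; apply: (@continuous_comp _ _ _ set_val fst).
    exact: initial_continuous.
  exact: cvg_fst.
have c2 (A : set (arr G * arr G)) : continuous (fun x : A => (\val x).2).
  move=> x; apply: (@continuous_comp _ _ _ set_val snd).
    exact: initial_continuous.
  exact: cvg_snd.
exists (fun x => to_set_type (mem1 x)); split; last by [].
split.
  apply: continuous_comp_initial; apply: continuous_pair; first exact: c1.
  apply: continuous_gmul; [exact: c1|exact: c2|].
  by case=> x xP; exact: (set_mem xP).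
exists (fun x => to_set_type (mem2 x)); split.
- apply: continuous_comp_initial; apply: continuous_pair; first exact: c1.
  apply: continuous_gmul; [|exact: c2|].
    move=> x.
    exact: (@continuous_comp _ _ _ (fun x : fprod _ _ => (\val x).1) (@ginv G)
             x (c1 _ x) (@ginv_continuous G _)).
  by case=> x xP /=; rewrite src_ginv; exact: (set_mem xP).
- case=> -[a b] ab; apply: val_inj => /=; have /= ab' := set_mem ab.
  by rewrite gmulVK.
- case=> -[a b] ab; apply: val_inj => /=; have /= ab' := set_mem ab.
  by rewrite gmulVKV.
Qed.

Definition unit_bundle : principalBundle G G := PrincipalBundle unit_principal.

End UnitBundle.

Section Tensor.
Variables (L H G : topGroupoid).
Variables (Q : principalBundle L H) (P : principalBundle H G).

Let QP := pbundleP Q.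
Let PP := pbundleP P.

Definition tensor_dom : topologicalType :=
  fprod (@banch _ _ Q) (@bproj _ _ P).

(* The diagonal action is h (q, p) = (q h^-1, h p). *)
Definition tensor_rel (x y : tensor_dom) : bool :=
  `[< exists h : arr H, [/\ src h = bproj (\val x).2,
        (\val y).1 = bract (\val x).1 (ginv h) &
        (\val y).2 = blact h (\val x).2] >].

Let domP (x : tensor_dom) : banch (\val x).1 = bproj (\val x).2.
Proof. by case: x => x xP; exact: (set_mem xP). Qed.

Lemma tensor_rel_refl : reflexive tensor_rel.
Proof.
move=> x; apply/asboolP; exists (gone (bproj (\val x).2)); split.
- exact: src_gone.
- by rewrite ginv_gone -domP (bract1 QP).
- by rewrite (blact1 PP).
Qed.

Lemma tensor_rel_sym : symmetric tensor_rel.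
Proof.
have half x y : tensor_rel x y -> tensor_rel y x.
  move=> /asboolP[h [hx e1 e2]]; apply/asboolP; exists (ginv h); split.
  - by rewrite src_ginv e2 (bproj_blact PP).
  - rewrite e1 ginvK -(bractM QP) ?domP ?tgt_ginv ?src_ginv//.
    by rewrite gmulVg hx -domP (bract1 QP).
  - rewrite e2 -(blactM PP) ?src_ginv//.
    by rewrite gmulVg hx (blact1 PP).
by move=> x y; apply/idP/idP; exact: half.
Qed.

Lemma tensor_rel_trans : transitive tensor_rel.
Proof.
move=> y x z /asboolP[h [hx e1 e2]] /asboolP[k [ky e3 e4]].
have kh : src k = tgt h by rewrite ky e2 (bproj_blact PP).
apply/asboolP; exists (gmul k h); split.
- by rewrite src_gmul.
- by rewrite e3 e1 ginvM// (bractM QP) ?domP ?tgt_ginv ?src_ginv.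
- by rewrite e4 e2 (blactM PP).
Qed.

Definition tensor_equiv :=
  EquivRel _ tensor_rel_refl tensor_rel_sym tensor_rel_trans.

Definition tensor_space := quotient_topology {eq_quot tensor_equiv}.

Definition tensor_proj (z : tensor_space) : obj L := bproj (\val (repr z)).1.
Definition tensor_anch (z : tensor_space) : obj G := banch (\val (repr z)).2.

(* insubd only takes its default value when the action is not defined, see   *)
(* tensor_lactE and tensor_ractE.                                            *)
Definition tensor_lact (k : arr L) (z : tensor_space) : tensor_space :=
  let x : tensor_dom := repr z in
  \pi_tensor_space (insubd x (blact k (\val x).1, (\val x).2)).
Definition tensor_ract (z : tensor_space) (g : arr G) : tensor_space :=
  let x : tensor_dom := repr z in
  \pi_tensor_space (insubd x ((\val x).1, bract (\val x).2 g)).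

Lemma tensor_classP (x y : tensor_dom) :
  \pi_tensor_space x = \pi_tensor_space y <-> tensor_rel x y.
Proof. by split=> [/eqmodP|?]; last exact/eqmodP. Qed.

Lemma tensor_projE x : tensor_proj (\pi_tensor_space x) = bproj (\val x).1.
Proof.
rewrite /tensor_proj; have : tensor_rel x (repr (\pi_tensor_space x)).
  by apply/tensor_classP; rewrite reprK.
move=> /asboolP[h [hx -> _]].
by rewrite (bproj_bract QP)// domP tgt_ginv.
Qed.

Lemma tensor_anchE x : tensor_anch (\pi_tensor_space x) = banch (\val x).2.
Proof.
rewrite /tensor_anch; have : tensor_rel x (repr (\pi_tensor_space x)).
  by apply/tensor_classP; rewrite reprK.
by move=> /asboolP[h [hx _ ->]]; rewrite (banch_blact PP).
Qed.

Lemma tensor_lactE k x (y : tensor_dom) : src k = bproj (\val x).1 ->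
  \val y = (blact k (\val x).1, (\val x).2) ->
  tensor_lact k (\pi_tensor_space x) = \pi_tensor_space y.
Proof.
move=> kx ey; rewrite /tensor_lact.
have : tensor_rel x (repr (\pi_tensor_space x)).
  by apply/tensor_classP; rewrite reprK.
move: (repr _) => z /asboolP[h [hx e1 e2]].
have xh : banch (\val x).1 = tgt (ginv h) by rewrite domP tgt_ginv.
have kz : src k = bproj (\val z).1 by rewrite e1 (bproj_bract QP).
apply/esym/tensor_classP/asboolP; exists h.
rewrite insubdK; last first.
  by rewrite inE /fprod/= (banch_blact QP)// domP.
by rewrite ey /= e1 e2; split => //; rewrite (blact_bract QP).
Qed.

Lemma tensor_ractE g x (y : tensor_dom) : banch (\val x).2 = tgt g ->
  \val y = ((\val x).1, bract (\val x).2 g) ->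
  tensor_ract (\pi_tensor_space x) g = \pi_tensor_space y.
Proof.
move=> xg ey; rewrite /tensor_ract.
have : tensor_rel x (repr (\pi_tensor_space x)).
  by apply/tensor_classP; rewrite reprK.
move: (repr _) => z /asboolP[h [hx e1 e2]].
have zg : banch (\val z).2 = tgt g by rewrite e2 (banch_blact PP).
apply/esym/tensor_classP/asboolP; exists h.
rewrite insubdK; last first.
  by rewrite inE /fprod/= (bproj_bract PP)// domP.
by rewrite ey /= e1 e2 (bproj_bract PP)//; split => //; rewrite (blact_bract PP).
Qed.

Definition tensor : bispace L G :=
  @Bispace L G tensor_space tensor_proj tensor_anch tensor_lact tensor_ract.

End Tensor.

(* P : H -> G has an inverse Q : G -> H in the Morita category. *)
Definition morita_equivalence (H G : topGroupoid) (P : principalBundle H G) :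
    Prop :=
  exists Q : principalBundle G H,
    isomorphic (tensor Q P) (unit_bundle G) /\
    isomorphic (tensor P Q) (unit_bundle H).

(* Main.v *)
(* A principal G-bundle P over H moves homomorphisms K -> H to homomorphisms  *)
(* K -> G by tau |-> P_q o tau, with q in the fibre over the base point of    *)
(* tau. Other choices of q conjugate the result in G, and conjugating tau in  *)
(* H does not change the set of results. Since pi has local sections, a path  *)
(* of homomorphisms into H is locally moved to a path of homomorphisms into   *)
(* G. Hence P moves hom(K, H; sigma) into hom(K, G; rho). An inverse bundle Q *)
(* moves hom(K, G; rho) back, because Q_q o P_p is a conjugation in H for     *)
(* P (x) Q isomorphic to the unit bundle. Both transports commute with        *)
(* precomposition by mu.                                                      *)
Require Import Defs.
From mathcomp Require Import all_boot all_order all_algebra.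
From mathcomp Require Import all_classical all_reals topology normedtype.
From mathcomp Require Import lra.

Import Order.TTheory GRing.Theory Num.Theory.
Import numFieldNormedType.Exports.
(* The [fprod] of finfun would otherwise shadow that of Defs. *)
Import Defs.

Set Implicit Arguments.
Unset Strict Implicit.
Unset Printing Implicit Defensive.

Local Open Scope classical_set_scope.

(** Write O(sigma) for hom(K, H; sigma), and likewise O(rho). For [psi] in O(rho), the transport Q_q
    o psi lies in O(sigma), and [psi] is a G-conjugate of P_p o Q_q o psi ([bundle_push_inverse]).
    Transport and conjugation act on values and [mu] on arguments, so they commute, and stability of
    O(sigma) under [mu] passes to O(rho) ([Mon_sub]). Exchanging P and Q gives the other inclusion.

    The main work is that transport maps orbits into orbits ([hom_orbit_push]). By minimality of
    orbits, it suffices that the [tau] whose transports all lie in O(rho) form a set closed under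
    conjugation and under paths. Conjugation is absorbed by a change of fibre point; paths are cut
    into pieces over which pi has a section ([path_closed_local]), the exponential law giving
    continuity ([continuous_bundle_push]). *)

Section PathClosed.
Variable R : realType.
Local Open Scope ring_scope.

(** * Paths, and unions of path components *)

Definition clamp (t : R) : R := Num.max 0 (Num.min 1 t).

Lemma clamp_itv t : 0 <= clamp t <= 1.
Proof. by rewrite /clamp le_max lexx ge_max ler01 ge_min lexx. Qed.

Lemma clampE t : 0 <= t <= 1 -> clamp t = t.
Proof. by case/andP=> t0 t1; rewrite /clamp min_r// max_r. Qed.

Lemma clamp_continuous : continuous clamp.
Proof.
move=> t; apply: (@continuous_max R R (fun=> 0) (fun t => Num.min 1 t)).
  exact: cvg_cst.
apply: (@continuous_min R R (fun=> 1) id); [exact: cvg_cst|exact: cvg_id].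
Qed.

(** Paths live on all of [R], avoiding subspace topologies; composing with [clamp] extends a path
    from [0, 1]. *)
Definition path_closed (X : topologicalType) (A : set X) : Prop :=
  forall gamma : R -> X, continuous gamma -> A (gamma 0) -> A (gamma 1).

Lemma path_componentP (X : topologicalType) (x y : X) :
  path_component R x y <->
  exists gamma : R -> X, [/\ continuous gamma, gamma 0 = x & gamma 1 = y].
Proof.
split=> [[gamma [cg <- <-]]|[gamma [cg <- <-]]]; last first.
  by exists gamma; split => //; exact: continuous_subspaceT.
exists (gamma \o clamp); rewrite /= !clampE ?lexx ?ler01//; split => //.
by apply: continuous_comp_within cg => [|t];
  [exact: clamp_continuous|rewrite /= in_itv/= clamp_itv].
Qed.

Lemma path_component_refl (X : topologicalType) (x : X) : path_component R x x.
Proof.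
by apply/path_componentP; exists (fun=> x); split=> // t; exact: cvg_cst.
Qed.

Lemma path_component_trans (X : topologicalType) (x y z : X) :
  path_component R x y -> path_component R y z -> path_component R x z.
Proof.
move=> /path_componentP[f [cf <- fy]] /path_componentP[g [cg gy <-]].
pose h t := if t <= 1 / 2 then f (2 * t) else g (2 * t - 1).
have c2 : continuous (fun t : R => 2 * t).
  by move=> t; apply: cvgMr; exact: cvg_id.
have c21 : continuous (fun t : R => 2 * t - 1).
  by move=> t; apply: cvgB; [exact: c2|exact: cvg_cst].
pose f2 (t : R) := f (2 * t); pose g2 (t : R) := g (2 * t - 1).
have hf t : t <= 1 / 2 -> h t = f2 t by rewrite /h => ->.
have hg t : 1 / 2 <= t -> h t = g2 t.
  rewrite /h /g2 => t1; case: ifPn => // t2.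
  have -> : t = 1 / 2 by apply/eqP; rewrite eq_le t1 t2.
  by rewrite (_ : 2 * (1 / 2) = 1 :> R) ?subrr ?gy//; lra.
exists h; split.
- have -> : `[0, 1]%classic = `[0, 1/2]%classic `|` `[1/2, 1]%classic :> set R.
    apply/seteqP; split => t /=; rewrite !in_itv /=.
      by move=> /andP[-> ->]; case: (leP t (1/2)) => [|/ltW ->]; [left|right].
    by case=> /andP[? ?]; apply/andP; split; lra.
  apply: withinU_continuous; [exact: itv_closed..| |].
    apply: (@subspace_eq_continuous R `[0, 1/2]%classic X f2).
      by move=> t; rewrite inE/= in_itv/= => /andP[_ t1]; exact/esym/hf.
    apply: continuous_subspaceT => t.
    apply: (@continuous_comp _ _ _ (fun t : R => 2 * t)); first exact: c2.
    exact: cf.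
  apply: (@subspace_eq_continuous R `[1/2, 1]%classic X g2).
    by move=> t; rewrite inE/= in_itv/= => /andP[t1 _]; exact/esym/hg.
  apply: continuous_subspaceT => t.
  apply: (@continuous_comp _ _ _ (fun t : R => 2 * t - 1)); first exact: c21.
  exact: cg.
- by rewrite hf /f2 ?mulr0//; lra.
- by rewrite hg /g2; [congr g; lra|lra].
Qed.

Lemma union_of_path_componentsP (X : topologicalType) (A : set X) :
  union_of_path_components R A <-> path_closed A.
Proof.
split=> [[S ->] gamma cg [x Sx xg]|pA].
  exists x => //; apply: path_component_trans xg _.
  by apply/path_componentP; exists gamma.
exists A; apply/seteqP; split=> [x Ax|y [x Ax /path_componentP[g [cg g0 <-]]]].
  by exists x => //; exact: path_component_refl.
by apply: pA => //; rewrite g0.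
Qed.

(** Connectedness of the line replaces an explicit subdivision of the path. *)
Lemma path_closed_local (X : topologicalType) (A : set X) :
  (forall x : X, exists2 U, nbhs x U &
     forall gamma : R -> X, continuous gamma ->
     (forall t, U (gamma t)) -> A (gamma 0) -> A (gamma 1)) ->
  path_closed A.
Proof.
move=> lA gamma cg A0.
(* gamma^-1(A) is clopen in R: near t, any two values of gamma are joined by a *)
(* reparametrized piece of gamma inside the neighbourhood given by lA.         *)
have loc t : \forall u \near t, A (gamma u) <-> A (gamma t).
  have [U Ut UA] := lA (gamma t).
  have /nbhs_ballP[e /= e0 eU] := cg t _ Ut.
  have step u v : ball t e u -> ball t e v -> A (gamma u) -> A (gamma v).
    move=> ut vt Au; pose c s : R := u + clamp s * (v - u).
    have cc : continuous c.
      move=> s; apply: cvgD; first exact: cvg_cst.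
      by apply: cvgMl; exact: clamp_continuous.
    have := UA (gamma \o c); rewrite /= /c !clampE ?lexx ?ler01//.
    rewrite mul0r addr0 mul1r subrKC; apply => //.
      by move=> s; apply: continuous_comp; [exact: cc|exact: cg].
    move=> s; apply: eU; rewrite /ball /= -/(c s) /c.
    have /andP[c0 c1] := clamp_itv s.
    move: ut vt; rewrite /ball /= !ltr_norml => /andP[a b] /andP[a' b'].
    by case: (leP u v) => [|/ltW] uv; apply/andP; split; nra.
  near=> u; have ut : ball t e u by near: u; exact: nbhsx_ballx.
  by split; apply: step => //; exact: ballxx.
pose B := gamma @^-1` A.
have oB : open B.
  rewrite openE => t Bt; rewrite /interior.
  by apply: filterS (loc t) => u /=; rewrite /B /= => ->.
have oCB : open (~` B).
  rewrite openE => t Bt; rewrite /interior.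
  by apply: filterS (loc t) => u /=; rewrite /B /= => ->.
have cT : connected [set: R] by apply/connected_intervalP => x y _ _ z _.
have BT : B = setT.
  apply: cT; first by exists 0.
    by exists B => //; rewrite setTI.
  by exists B; [rewrite -(setCK B); exact: open_closedC|rewrite setTI].
by have : B 1 by rewrite BT.
Unshelve. all: by end_near. Qed.

End PathClosed.

(** * Orbits of homomorphisms *)

Section Orbit.
Variables (R : realType) (K : topologicalGroupType) (G : topGroupoid).
Implicit Types phi rho : gpdHom K G.

Lemma hom_orbit_refl rho : hom_orbit R rho rho.
Proof. by move=> A [_]; exact. Qed.

Lemma hom_orbit_path_closed rho : path_closed R (hom_orbit R rho).
Proof.
move=> gamma cg g0 A [[pA iA] rA].
by apply: (union_of_path_componentsP R A).1 => //; exact: g0.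
Qed.

Lemma hom_orbit_invariant rho : groupoid_invariant (hom_orbit R rho).
Proof.
move=> g phi e phiA A [[pA iA] rA].
by apply: (iA g phi e); apply: phiA.
Qed.

Lemma hom_orbit_min rho (A : set (gpdHom K G)) :
  path_closed R A -> groupoid_invariant A -> A rho -> hom_orbit R rho `<=` A.
Proof.
move=> pA iA rA phi; apply; split=> [|_ ->//].
by split=> //; exact/union_of_path_componentsP.
Qed.

Lemma hom_orbit_sub phi rho :
  hom_orbit R rho phi -> hom_orbit R phi `<=` hom_orbit R rho.
Proof.
apply: hom_orbit_min; first exact: hom_orbit_path_closed.
exact: hom_orbit_invariant.
Qed.

Lemma hom_act_ginv g phi (e : src g = hom_base phi)
    (e' : src (ginv g) = hom_base (hom_act e)) : hom_act e' = phi.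
Proof.
apply: gpdHomP => [|k]; first by rewrite /= tgt_ginv.
have [sk tk] := hom_isotropy phi k.
have gk : src g = tgt (phi k) by rewrite tk.
rewrite /= /conj_map /= /conj_map ginvK gmulA ?src_ginv ?tgt_gmul//; last first.
  by rewrite src_gmul// tgt_ginv sk.
by rewrite gmulVK// gmulKV// sk.
Qed.

End Orbit.

(** * Transport along a bundle and choice of the fibre point *)

Section Push.
Variables (H G : topGroupoid) (P : principalBundle H G).
Implicit Types p q : P.
Let PP := pbundleP P.

Lemma fibre_transitive p q : bproj p = bproj q ->
  exists2 g, banch p = tgt g & q = bract p g.
Proof.
have [f [[_ [f' [_ _ f'K]]] fE]] := bract_homeo PP.
move=> pq; have := fE (f' (to_set_type (pq : fprod _ _ (p, q)))).
rewrite f'K {1}set_valE /=; case: (f' _) => -[p' g] pg.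
rewrite !set_valE /= => -[-> ->]; exists g => //.
exact: (set_mem pg).
Qed.

(** P_p(h) is the second component of the inverse of (p, g) |-> (p, pg) at (p, hp), hence jointly
    continuous in p and h. *)
Lemma continuous_bundle_map (T : topologicalType) (u : T -> P)
    (v : T -> arr H) :
  continuous u -> continuous v -> (forall t, v t \in isotropy (bproj (u t))) ->
  continuous (fun t => bundle_map (u t) (v t)).
Proof.
move=> cu cv vI.
have sv t : src (v t) = bproj (u t) by have := vI t; rewrite inE => -[].
have tv t : tgt (v t) = bproj (u t) by have := vI t; rewrite inE => -[].
have [f [[_ [f' [cf' _ f'K]]] fE]] := bract_homeo PP.
have puv t : fprod (@bproj _ _ P) (@bproj _ _ P) (u t, blact (v t) (u t)).
  by rewrite /fprod/= (bproj_blact PP) ?tv.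
pose w t : fprod (@bproj _ _ P) (@bproj _ _ P) := to_set_type (puv t).
have cw : continuous w.
  apply: continuous_comp_initial; apply: continuous_pair => //.
  exact: (continuous_comp_within (continuous_pair cv cu)
            (sv : forall t, fprod _ _ (v t, u t)) (blact_continuous PP)).
have -> : (fun t => bundle_map (u t) (v t)) = snd \o (set_val \o (f' \o w)).
  apply/funext => t /=.
  have := fE (f' (w t)); rewrite f'K {1}set_valE /=.
  case: (f' (w t)) => -[q g] qg; rewrite !set_valE /= => -[pq eh]; subst q.
  move/set_mem: qg => /= pg.
  exact: bundle_map_unique.
move=> t; apply: continuous_comp; last exact: cvg_snd.
apply: continuous_comp; last exact: initial_continuous.
by apply: continuous_comp; [exact: cw|exact: cf'].
Qed.

Variable K : topologicalGroupType.
Implicit Types sigma : gpdHom K H.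

Lemma hom_map_isotropy sigma p k : bproj p = hom_base sigma ->
  sigma k \in isotropy (bproj p).
Proof. by move=> ->; rewrite inE; exact: hom_isotropy. Qed.

Lemma bundle_push_ract sigma p q g (ep : bproj p = hom_base sigma)
    (eq : bproj q = hom_base sigma) (e : src g = hom_base (bundle_push eq)) :
  banch p = tgt g -> q = bract p g -> hom_act e = bundle_push ep.
Proof.
move=> pg qE; apply: gpdHomP => [|k]; first by rewrite /= pg.
have sI := hom_map_isotropy k ep; have sI' := hom_map_isotropy k eq.
have [[sb tb] eb] := bundle_mapP sI'.
have [sk tk] : isotropy (bproj p) (sigma k) by rewrite -inE.
have sg : src g = banch q := e.
rewrite /= /conj_map /=; move: (bundle_map q _) sb tb eb => c sc tc ec.
have gc : src g = tgt c by rewrite sg tc.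
have gcg : src (gmul g c) = tgt (ginv g) by rewrite src_gmul// tgt_ginv sc.
apply/esym/bundle_map_unique => //; first by rewrite !tgt_gmul.
rewrite (bractM PP)//; last by rewrite tgt_gmul.
rewrite (bractM PP)// -qE -ec qE (blact_bract PP)//.
have hg : banch (blact (sigma k) p) = tgt g by rewrite (banch_blact PP).
by rewrite -(bractM PP) ?tgt_ginv// gmulgV -hg (bract1 PP).
Qed.

(** (hkh^-1)(hp) = h(kp) = (hp)P_p(k). *)
Lemma bundle_push_lact sigma p q h (e : src h = hom_base sigma)
    (ep : bproj p = hom_base sigma) (eq : bproj q = hom_base (hom_act e)) :
  q = blact h p -> bundle_push eq = bundle_push ep.
Proof.
move=> qE; have sh : src h = bproj p by rewrite e ep.
apply: gpdHomP => [|k]; first by rewrite /= qE (banch_blact PP).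
have sI := hom_map_isotropy k ep; have [[sb tb] eb] := bundle_mapP sI.
have sI' := hom_map_isotropy k eq.
have [sk tk] : isotropy (bproj p) (sigma k) by rewrite -inE.
apply: bundle_map_unique => //; first by rewrite qE (banch_blact PP).
rewrite /= /conj_map {1}qE -(blactM PP)//; last first.
  by rewrite src_gmul ?src_ginv// src_gmul ?tk ?tgt_ginv ?sk// -sh.
rewrite gmulKV; last by rewrite src_gmul ?sk ?tk// -sh.
by rewrite (blactM PP) ?sk ?tk// eb (blact_bract PP)// -qE.
Qed.

Lemma bundle_push_precomp sigma p mu (e : bproj p = hom_base sigma)
    (e' : bproj p = hom_base (hom_precomp sigma mu)) :
  bundle_push e' = hom_precomp (bundle_push e) mu.
Proof. exact: gpdHomP. Qed.

End Push.

(** * Continuity of transport, and its effect on orbits *)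

Section Transport.
Variables (R : realType) (K : topologicalGroupType).
Hypotheses (K_lc : locally_compact [set: K]) (K_hausdorff : hausdorff_space K).

(** Evaluation is jointly continuous because K is locally compact Hausdorff. *)
Lemma continuous_hom_eval (G : topGroupoid) (T : topologicalType)
    (u : T -> gpdHom K G) (v : T -> K) :
  continuous u -> continuous v -> continuous (fun t => u t (v t)).
Proof.
move=> cu cv.
have ce : continuous (uncurry (@hom_map K G)).
  apply: continuous_uncurry => //; last by move=> phi; exact: hom_continuous.
  exact: initial_continuous.
have -> : (fun t => u t (v t)) =
    uncurry (@hom_map K G) \o (fun t => (u t, v t)) by [].
move=> t; apply: continuous_comp; last exact: ce.
exact: continuous_pair.
Qed.

Lemma continuous_hom_curry (G : topGroupoid) (T : topologicalType)
    (u : T -> gpdHom K G) :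
  continuous (fun x : T * K => u x.1 x.2) -> continuous u.
Proof.
move=> cu; apply: continuous_comp_initial.
exact: (continuous_curry_fun cu).
Qed.

Lemma hom_base_continuous (G : topGroupoid) : continuous (@hom_base K G).
Proof.
have ce : continuous (fun phi : gpdHom K G => phi 1%g).
  apply: (@continuous_hom_eval _ _ id (fun=> 1%g)) => x; first exact: cvg_id.
  exact: cst_continuous.
have -> : @hom_base K G = (fun phi => src (phi 1%g)).
  by apply/funext => phi; case: (hom_isotropy phi 1%g).
move=> phi.
apply: (@continuous_comp _ _ _ (fun psi : gpdHom K G => psi 1%g) (@src G)).
  exact: ce.
exact: src_continuous.
Qed.

Variables (H G : topGroupoid) (P : principalBundle H G).
Let PP := pbundleP P.

Lemma continuous_bundle_push (T : topologicalType) (tau : T -> gpdHom K H)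
    (q : T -> P) (e : forall t, bproj (q t) = hom_base (tau t)) :
  continuous tau -> continuous q -> continuous (fun t => bundle_push (e t)).
Proof.
move=> ctau cq; apply: continuous_hom_curry => /=.
have cfst : continuous (@fst T K) by move=> x; exact: cvg_fst.
have csnd : continuous (@snd T K) by move=> x; exact: cvg_snd.
apply: (@continuous_bundle_map _ _ P _ (q \o fst)
  (fun x => tau x.1 x.2)) => [x||x].
- by apply: continuous_comp; [exact: cfst|exact: cq].
- apply: continuous_hom_eval => // x.
  by apply: continuous_comp; [exact: cfst|exact: ctau].
- exact: (hom_map_isotropy x.2 (e x.1)).
Qed.

Lemma invariant_bundle_push (O : set (gpdHom K G)) (tau : gpdHom K H) (p q : P)
    (ep : bproj p = hom_base tau) (eq : bproj q = hom_base tau) :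
  groupoid_invariant O -> O (bundle_push ep) -> O (bundle_push eq).
Proof.
move=> iO Op; have [g qg pE] := fibre_transitive (etrans eq (esym ep)).
have e : src g = hom_base (bundle_push ep).
  by rewrite /= pE (banch_bract PP).
by rewrite -(bundle_push_ract eq e qg pE); exact: iO.
Qed.

Lemma hom_orbit_push (sigma tau : gpdHom K H) (p q : P)
    (ep : bproj p = hom_base sigma) (eq : bproj q = hom_base tau) :
  hom_orbit R sigma tau -> hom_orbit R (bundle_push ep) (bundle_push eq).
Proof.
set O := hom_orbit R (bundle_push ep).
have iO : groupoid_invariant O by exact: hom_orbit_invariant.
(* Quantifying over every fibre point makes membership independent of the local section used on each
   piece of a path. *)
pose A := [set tau : gpdHom K H |
  forall (q : P) (eq : bproj q = hom_base tau), O (bundle_push eq)].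
suff : hom_orbit R sigma `<=` A by move=> sA /sA; exact.
apply: hom_orbit_min.
- apply: path_closed_local => phi.
  have [U [s [oU Uphi cs sE]]] := bproj_local_sections PP (hom_base phi).
  exists (@hom_base K H @^-1` U).
    by apply: hom_base_continuous; exact: open_nbhs_nbhs.
  move=> gamma cg gU A0 q1 e1.
  have e t : bproj (s (hom_base (gamma t))) = hom_base (gamma t).
    by apply: sE; exact: gU.
  (* Replace [q1] by the value of the section, the endpoint of a path of transports starting in
     [O]. *)
  apply: (invariant_bundle_push (ep := e 1%R) _ iO).
  apply: (@hom_orbit_path_closed R _ _ _ (fun t => bundle_push (e t))).
    apply: continuous_bundle_push => //.
    apply: continuous_comp_within cs => // t.
    by apply: continuous_comp; [exact: cg|exact: hom_base_continuous].
  exact: A0.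
- move=> h phi e Aphi q1 e1.
  have hq : src (ginv h) = bproj q1 by rewrite src_ginv e1.
  have e0 : bproj (blact (ginv h) q1) = hom_base phi.
    by rewrite (bproj_blact PP)// tgt_ginv.
  rewrite (bundle_push_lact e0); first exact: Aphi.
  by rewrite -(blactM PP) ?tgt_ginv// gmulgV -src_ginv hq (blact1 PP).
- move=> q1 e1; apply: (invariant_bundle_push (ep := ep) e1 iO).
  exact: hom_orbit_refl.
Qed.

End Transport.

(** * Transport back along the inverse bundle *)

Lemma groupoid_invariant_inv (K : topologicalGroupType) (G : topGroupoid)
    (O : set (gpdHom K G)) g phi (e : src g = hom_base phi) :
  groupoid_invariant O -> O (hom_act e) -> O phi.
Proof.
move=> iO Oe.
have e' : src (ginv g) = hom_base (hom_act e) by rewrite src_ginv.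
by rewrite -(hom_act_ginv e'); exact: iO.
Qed.

Lemma hom_act_precomp (K : topologicalGroupType) (G : topGroupoid) g
    (phi : gpdHom K G) mu (e : src g = hom_base phi) :
  hom_precomp (hom_act e) mu = hom_act (e : _ = hom_base (hom_precomp phi mu)).
Proof. exact: gpdHomP. Qed.

Section Inverse.
Variables (H G : topGroupoid).
Variables (P : principalBundle H G) (Q : principalBundle G H).
Variable K : topologicalGroupType.
Let PP := pbundleP P.
Let QP := pbundleP Q.

(** The conjugating arrow is the image of p (x) q in the unit bundle. Equivariance of the
    isomorphism turns k(p (x) q) = (p (x) q)Q_q(P_p(k)) into a conjugation relation in H. *)
Lemma bundle_push_inverse (tau : gpdHom K H) (p : P) (q : Q)
    (ep : bproj p = hom_base tau) (eq : bproj q = hom_base (bundle_push ep)) :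
  isomorphic (tensor P Q) (unit_bundle H) ->
  exists h (e : src h = hom_base (bundle_push eq)), hom_act e = tau.
Proof.
case=> f [_ fE flact fract].
pose x : tensor_dom P Q := to_set_type (esym eq : fprod _ _ (p, q)).
pose z : tensor P Q := (\pi_(tensor_space P Q) x)%qT.
have [th sh] := fE z; exists (f z).
have e : src (f z) = hom_base (bundle_push eq).
  by rewrite -[src _]/(banch (f z)) sh; exact: tensor_anchE.
have {}th : tgt (f z) = bproj p.
  by rewrite -[tgt _]/(bproj (f z)) th; exact: tensor_projE.
exists e; apply: gpdHomP => [|k]; first by rewrite /= th.
have [[sg tg] eg] := bundle_mapP (hom_map_isotropy k ep).
have [[sc tc] ec] := bundle_mapP (hom_map_isotropy k eq).
have [sk tk] : isotropy (bproj p) (tau k) by rewrite ep; exact: hom_isotropy.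
rewrite /= /conj_map /=; rewrite /= in sc tc ec.
set g := bundle_map p _ in sg tg eg sc tc ec *.
set c := bundle_map q g in sc tc ec *.
suff <- : gmul (tau k) (f z) = gmul (f z) c.
  by rewrite -gmulA ?tgt_ginv ?th// gmulgV th -sk gmulg1.
have y1P : fprod (@banch _ _ P) (@bproj _ _ Q) (blact (tau k) p, q).
  by rewrite /fprod/= (banch_blact PP).
have y2P : fprod (@banch _ _ P) (@bproj _ _ Q) (p, bract q c).
  by rewrite /fprod/= (bproj_bract QP).
pose y1 : tensor_dom P Q := to_set_type y1P.
pose y2 : tensor_dom P Q := to_set_type y2P.
have kz : src (tau k) = bproj z by rewrite sk /z; exact/esym/tensor_projE.
have cz : banch z = tgt c by rewrite tc /z; exact: tensor_anchE.
rewrite -[gmul (tau k) _]/(blact (tau k) (f z)) -flact//.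
rewrite -[gmul (f z) _]/(bract (f z) c) -fract//; congr f.
(* h (p (x) q) = (hp) (x) q = (p P_p(h)) (x) q = p (x) (P_p(h) q), and the     *)
(* last one is (p (x) q) Q_q(P_p(h)).                                         *)
rewrite [LHS](@tensor_lactE _ _ _ _ _ _ x y1)//.
rewrite [RHS](@tensor_ractE _ _ _ _ _ _ x y2)//.
apply/tensor_classP/asboolP; exists g => /=; split.
- by rewrite sg; exact: esym eq.
- by rewrite eg -(bractM PP) ?tgt_ginv// gmulgV tg (bract1 PP).
- by rewrite ec.
Qed.

End Inverse.

(** * Comparison of the monodromy groups *)

Lemma Mon_sub (R : realType) (K : topologicalGroupType) (H G : topGroupoid)
    (P : principalBundle H G) (Q : principalBundle G H)
    (sigma : gpdHom K H) (rho : gpdHom K G) :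
  isomorphic (tensor Q P) (unit_bundle G) ->
  (forall tau (p : P) (e : bproj p = hom_base tau),
     hom_orbit R sigma tau -> hom_orbit R rho (bundle_push e)) ->
  (forall psi (q : Q) (e : bproj q = hom_base psi),
     hom_orbit R rho psi -> hom_orbit R sigma (bundle_push e)) ->
  Mon R sigma `<=` Mon R rho.
Proof.
move=> QP_unit pushP pushQ mu mu_sigma.
have iO := @hom_orbit_invariant R _ _ rho.
apply/seteqP; split=> [_ [psi psiO <-]|psi psiO];
  have [q eq] := bproj_surj (pbundleP Q) (hom_base psi);
  have [p ep] := bproj_surj (pbundleP P) (hom_base (bundle_push eq));
  have [g [e eg]] := bundle_push_inverse ep QP_unit;
  have tauO := pushQ _ _ eq psiO.
- rewrite -eg hom_act_precomp.
  apply: iO.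
  rewrite -(bundle_push_precomp ep (ep : _ = hom_base (hom_precomp _ mu))).
  by apply: pushP; rewrite -mu_sigma; exists (bundle_push eq).
- move: tauO; rewrite -mu_sigma => -[tau' tau'O tauE].
  (* Generalizing the transport and all that depends on it lets it be replaced by [tau'] o [mu]. *)
  move: (bundle_push eq) tauE p ep g e eg => _ <- p ep g e eg.
  exists (hom_act (e : _ = hom_base (bundle_push (ep : _ = hom_base tau')))).
    by apply: iO; exact: pushP.
  by rewrite hom_act_precomp -eg; apply: gpdHomP.
Qed.

Theorem mainTheorem3 (R : realType) (K : topologicalGroupType)
  (K_lc : locally_compact [set: K]) (K_hausdorff : hausdorff_space K)
  (G H : topGroupoid) (P : principalBundle H G)
  (P_morita : morita_equivalence P)
  (sigma : gpdHom K H) (p : P) (p_sigma : bproj p = hom_base sigma) :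
  Mon R sigma = Mon R (bundle_push p_sigma).
Proof.
have [Q [QP_unit PQ_unit]] := P_morita.
have pushP tau (p' : P) (e : bproj p' = hom_base tau) :
    hom_orbit R sigma tau -> hom_orbit R (bundle_push p_sigma) (bundle_push e).
  exact: hom_orbit_push.
have pushQ psi (q : Q) (e : bproj q = hom_base psi) :
    hom_orbit R (bundle_push p_sigma) psi -> hom_orbit R sigma (bundle_push e).
  have [q0 e0] := bproj_surj (pbundleP Q) (banch p).
  have {}e0 : bproj q0 = hom_base (bundle_push p_sigma) by [].
  (* Transport by Q lands in the orbit of Q_q0 o P_p o sigma, which is conjugate to [sigma]. *)
  move=> psiO; apply: (@hom_orbit_sub _ _ _ (bundle_push e0)).
    have [h [eh ehE]] := bundle_push_inverse e0 PQ_unit.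
    apply: (@groupoid_invariant_inv _ _ (hom_orbit R sigma) _ _ eh).
      exact: hom_orbit_invariant.
    by rewrite ehE; exact: hom_orbit_refl.
  exact: hom_orbit_push.
by apply/seteqP; split; [exact: Mon_sub pushP pushQ|exact: Mon_sub pushQ pushP].
Qed.
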